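(* Let $X$ be an affine algebraic manifold whose group $\mathrm{Aut}\,X$ of algebraic automorphisms acts transitively on $X$, and let $T$ be the $\mathbb C[X]$-module of all algebraic vector fields on $X$. Suppose there is a $\mathbb C[X]$-submodule $L\subset T$ such that $L\subset\mathrm{Lie}_{alg}(X)$ and such that the fiber $\{\nu(x_0):\nu\in L\}$ of $L$ at some point $x_0\in X$ contains a generating subset of $T_{x_0}X$. Then $X$ has the algebraic density property.
   Context: $\mathbb C[X]$ is the algebra of regular functions. An algebraic vector field is completely integrable if its (holomorphic) flow exists for all complex times. $\mathrm{Lie}_{alg}(X)$ is the Lie algebra generated by completely integrable algebraic vector fields on $X$; $X$ has the algebraic density property if $\mathrm{Lie}_{alg}(X)$ equals the Lie algebra of all algebraic vector fields on $X$. A finite subset $F\subset T_{x_0}X$ is a generating subset if the linear span of its orbit under the (differentials of the) isotropy group $(\mathrm{Aut}\,X)_{x_0}$ is all of $T_{x_0}X$. *)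

(* Defs.v *)
(* The complex numbers are modelled as
   R[i] (real-closed 'complex' construction) over an arbitrary R : realType
   (every realType is a copy of the real numbers). *)
From mathcomp Require Import all_boot all_algebra.
From mathcomp Require Import complex.
From mathcomp Require Import all_classical all_reals all_analysis.
Set Implicit Arguments. Unset Strict Implicit. Unset Printing Implicit Defensive.
Import GRing.Theory Num.Theory numFieldNormedType.Exports.
Local Open Scope ring_scope.
Local Open Scope classical_set_scope.

Notation CC R := (R[i])%C.
Notation pt R n := ('rV[(R[i])%C]_n).

Inductive polyfun (R : realType) (n : nat) : (pt R n -> CC R) -> Prop :=
| PFconst (c : CC R) : polyfun (fun _ => c)
| PFcoord (i : 'I_n) : polyfun (fun x => x ord0 i)
| PFadd (f g : pt R n -> CC R) :
    polyfun f -> polyfun g -> polyfun (fun x => f x + g x)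
| PFmul (f g : pt R n -> CC R) :
    polyfun f -> polyfun g -> polyfun (fun x => f x * g x).

Definition polymap (R : realType) (n : nat) (phi : pt R n -> pt R n) : Prop :=
  forall i : 'I_n, polyfun (fun x => phi x ord0 i).

Definition affine_alg_set (R : realType) (n : nat) (X : set (pt R n)) : Prop :=
  exists (m : nat) (F : 'I_m -> pt R n -> CC R),
    (forall j, polyfun (F j)) /\ X = [set x | forall j, F j x = 0].

Definition vanishes_on (R : realType) (n : nat) (X : set (pt R n))
  (f : pt R n -> CC R) : Prop := forall x, X x -> f x = 0.

Definition Dfun (R : realType) (n : nat) (f : pt R n -> CC R) (x v : pt R n)
  : CC R := 'D_v (f : pt R n -> (CC R)^o) x.
Definition Dmap (R : realType) (n : nat) (phi : pt R n -> pt R n) (x v : pt R n)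
  : pt R n := 'D_v phi x.

Definition tangent (R : realType) (n : nat) (X : set (pt R n)) (x v : pt R n)
  : Prop :=
  forall f, polyfun f -> vanishes_on X f -> Dfun f x v = 0.

Definition smooth_set (R : realType) (n : nat) (X : set (pt R n)) : Prop :=
  forall x, X x ->
  exists (m : nat) (g : 'I_m -> pt R n -> CC R),
    (forall j, polyfun (g j) /\ vanishes_on X (g j)) /\
    (forall c : 'I_m -> CC R,
        (forall v, \sum_(j < m) c j * Dfun (g j) x v = 0) -> forall j, c j = 0) /\
    (exists e : CC R, 0 < e /\
       forall y : pt R n, `|y - x| < e -> (forall j, g j y = 0) -> X y).

Definition affine_alg_manifold (R : realType) (n : nat) (X : set (pt R n)) : Prop :=
  affine_alg_set X /\ smooth_set X.

(* Algebraic vector fields on X, represented by polynomial vector fields on C^n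
   tangent to X; two representatives agreeing on X give the same field. *)
Definition alg_vf (R : realType) (n : nat) (X : set (pt R n))
  (nu : pt R n -> pt R n) : Prop :=
  polymap nu /\ forall x, X x -> tangent X x (nu x).

Definition eq_on (R : realType) (n : nat) (X : set (pt R n))
  (nu mu : pt R n -> pt R n) : Prop := forall x, X x -> nu x = mu x.

Definition vf_bracket (R : realType) (n : nat) (nu mu : pt R n -> pt R n)
  : pt R n -> pt R n := fun x => Dmap mu x (nu x) - Dmap nu x (mu x).

Definition compl_integrable (R : realType) (n : nat) (X : set (pt R n))
  (nu : pt R n -> pt R n) : Prop :=
  alg_vf X nu /\
  forall x, X x -> exists gamma : (CC R)^o -> pt R n,
    gamma 0 = x /\
    forall t : (CC R)^o, X (gamma t) /\ derivable gamma t 1 /\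
                         gamma^`() t = nu (gamma t).

(* Lie_alg(X): the Lie algebra generated by completely integrable algebraic
   vector fields (as a set of fields modulo agreement on X). *)
Inductive Lie_alg (R : realType) (n : nat) (X : set (pt R n))
  : (pt R n -> pt R n) -> Prop :=
| LAci nu : compl_integrable X nu -> Lie_alg X nu
| LAadd nu mu : Lie_alg X nu -> Lie_alg X mu -> Lie_alg X (fun x => nu x + mu x)
| LAscale (c : CC R) nu : Lie_alg X nu -> Lie_alg X (fun x => c *: nu x)
| LAbracket nu mu : Lie_alg X nu -> Lie_alg X mu -> Lie_alg X (vf_bracket nu mu)
| LAeq nu mu : Lie_alg X nu -> alg_vf X mu -> eq_on X nu mu -> Lie_alg X mu.

Definition algebraic_density (R : realType) (n : nat) (X : set (pt R n)) : Prop :=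
  forall nu, alg_vf X nu -> Lie_alg X nu.

Definition alg_aut (R : realType) (n : nat) (X : set (pt R n))
  (phi : pt R n -> pt R n) : Prop :=
  polymap phi /\ (forall x, X x -> X (phi x)) /\
  exists psi : pt R n -> pt R n,
    polymap psi /\ (forall x, X x -> X (psi x)) /\
    (forall x, X x -> psi (phi x) = x) /\ (forall x, X x -> phi (psi x) = x).

Definition aut_transitive (R : realType) (n : nat) (X : set (pt R n)) : Prop :=
  forall x y, X x -> X y -> exists phi, alg_aut X phi /\ phi x = y.

Definition generating_subset (R : realType) (n : nat) (X : set (pt R n))
  (x0 : pt R n) (F : seq (pt R n)) : Prop :=
  (forall v, v \in F -> tangent X x0 v) /\
  forall w, tangent X x0 w ->
    exists (k : nat) (c : 'I_k -> CC R) (phi : 'I_k -> pt R n -> pt R n)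
           (v : 'I_k -> pt R n),
      (forall j, [/\ alg_aut X (phi j), phi j x0 = x0 & v j \in F]) /\
      w = \sum_(j < k) c j *: Dmap (phi j) x0 (v j).

Definition vf_submodule (R : realType) (n : nat) (X : set (pt R n))
  (L : set (pt R n -> pt R n)) : Prop :=
  [/\ (forall nu, L nu -> alg_vf X nu),
      L (fun _ => 0),
      (forall nu mu, L nu -> L mu -> L (fun x => nu x + mu x)),
      (forall f nu, polyfun f -> L nu -> L (fun x => f x *: nu x)) &
      (forall nu mu, L nu -> alg_vf X mu -> eq_on X nu mu -> L mu)].

(* Main.v *)
(* The largest C[X]-submodule M of T contained in Lie_alg(X) contains L and is stable under
   push-forward by automorphisms. Moving L around the isotropy group of x0, and then along
   X by transitivity, shows that M has full fiber T_x X at every point x.  Given an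
   algebraic field nu, the ideal of polynomials f with f nu in M then has no zero on X: if x
   is in X, pick polynomial gradients G(y) of equations of X whose common kernel at x is
   T_x X, and fields of M, as the rows of A(y), spanning T_x X.  For suitable constant
   matrices C and U the matrix E(y) = G(y) C + U A(y) is the identity at x, and it maps
   algebraic fields into M since they are annihilated by G; by Cayley-Hamilton,
   det(E) nu is in M.  Hence 1 is in the ideal by the Nullstellensatz, which is proved from
   the uncountability of C. *)
From HB Require Import structures.
Require Import Defs.
From mathcomp Require Import all_boot all_algebra finmap.
From mathcomp Require Import complex ring.
From mathcomp Require Import all_classical all_reals all_analysis.
Import GRing.Theory Num.Theory numFieldNormedType.Exports.
Set Implicit Arguments.
Unset Strict Implicit.
Unset Printing Implicit Defensive.
Local Open Scope ring_scope.
Local Open Scope classical_set_scope.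

(** * Derivatives of polynomial maps *)

Local Notation ptV R n := ('rV[(CC R)]_n : normedModType (CC R)).

Section Calculus.
Context {R : realType} {n : nat}.
Implicit Types (f g : pt R n -> CC R) (phi psi nu mu : pt R n -> pt R n).
Implicit Types (x v w : pt R n).

Lemma polyfun_opp f : polyfun f -> polyfun (fun x => - f x).
Proof.
move=> pf; have -> : (fun x => - f x) = (fun x => (-1) * f x).
  by apply/funext => x; rewrite mulN1r.
by apply: PFmul pf; exact: PFconst.
Qed.

Lemma polyfun_sum (I : Type) (r : seq I) (P : pred I) (F : I -> pt R n -> CC R) :
  (forall i, polyfun (F i)) -> polyfun (fun x => \sum_(i <- r | P i) F i x).
Proof.
move=> pF; elim: r => [|i r IH].
  under eq_fun do rewrite big_nil; exact: PFconst.
under eq_fun do rewrite big_cons.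
by case: (P i); [exact: PFadd|].
Qed.

Lemma polyfun_prod (I : Type) (r : seq I) (P : pred I) (F : I -> pt R n -> CC R) :
  (forall i, polyfun (F i)) -> polyfun (fun x => \prod_(i <- r | P i) F i x).
Proof.
move=> pF; elim: r => [|i r IH].
  under eq_fun do rewrite big_nil; exact: PFconst.
under eq_fun do rewrite big_cons.
by case: (P i); [exact: PFmul|].
Qed.

Lemma polyfun_comp f phi : polyfun f -> polymap phi -> polyfun (f \o phi).
Proof.
move=> pf pphi; elim: pf => [c|i|{}f g _ pf _ pg|{}f g _ pf _ pg].
- exact: PFconst.
- exact: pphi.
- exact: PFadd.
- exact: PFmul.
Qed.

Lemma coord_linear i : linear (fun x => x ord0 i : (CC R)^o).
Proof. by move=> a x v; rewrite !mxE. Qed.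

Lemma polyfun_differentiable f (x : ptV R n) :
  polyfun f -> differentiable (f : pt R n -> (CC R)^o) x.
Proof.
elim=> [c|i|{}f g _ df _ dg|{}f g _ df _ dg].
- exact: differentiable_cst.
- exact: differentiable_coord.
- exact: (differentiableD df dg).
- exact: (differentiableM df dg).
Qed.

Lemma polymap_differentiable phi (x : ptV R n) : polymap phi -> differentiable phi x.
Proof.
(* Expanding [phi] in the standard basis reduces the claim to its scalar coordinates. *)
move=> pphi; have -> : phi = \sum_(i < n) (fun y => phi y ord0 i *: delta_mx 0 i).
  apply/funext => y; rewrite fct_sumE [LHS]matrix_sum_delta big_ord1.
  by apply: eq_bigr => i _; rewrite ord1.
apply: differentiable_sum => i.
exact: (@differentiableZl (CC R) (ptV R n) (ptV R n) (fun y => phi y ord0 i)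
  (delta_mx 0 i) x (polyfun_differentiable x (pphi i))).
Qed.

(* Locked copies of the derivatives: otherwise unification unfolds them down to
   limits of filters. *)
Fact derivative_key : unit. Proof. exact: tt. Qed.
Definition dfun := locked_with derivative_key (@Dfun R n).
Definition dmap := locked_with derivative_key (@Dmap R n).

Lemma dfunE : dfun = @Dfun R n. Proof. exact: unlock. Qed.
Lemma dmapE : dmap = @Dmap R n. Proof. exact: unlock. Qed.

Lemma vf_bracketE nu mu x :
  vf_bracket nu mu x = dmap mu x (nu x) - dmap nu x (mu x).
Proof. by rewrite dmapE. Qed.

Lemma dfun_diff f x v : polyfun f -> dfun f x v = 'd (f : pt R n -> (CC R)^o) (x : ptV R n) v.
Proof. by move=> pf; rewrite dfunE /Dfun deriveE//; exact: polyfun_differentiable. Qed.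

Lemma dmap_diff phi x v : polymap phi -> dmap phi x v = 'd phi (x : ptV R n) v.
Proof. by move=> pf; rewrite dmapE /Dmap deriveE//; exact: polymap_differentiable. Qed.

Lemma dfun_lin f x a v w : polyfun f ->
  dfun f x (a *: v + w) = a * dfun f x v + dfun f x w.
Proof. by move=> pf; rewrite !dfun_diff// linearP. Qed.

Lemma dmap_lin phi x a v w : polymap phi ->
  dmap phi x (a *: v + w) = a *: dmap phi x v + dmap phi x w.
Proof. by move=> pf; rewrite !dmap_diff// linearP. Qed.

Lemma dfun_const c x v : dfun (fun=> c) x v = 0.
Proof. rewrite dfunE; exact: (@derive_cst (CC R) (ptV R n) (CC R)^o). Qed.

Lemma dfunD f g x v : polyfun f -> polyfun g ->
  dfun (fun y => f y + g y) x v = dfun f x v + dfun g x v.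
Proof.
move=> pf pg; rewrite (dfun_diff _ _ pf) (dfun_diff _ _ pg) (dfun_diff _ _ (PFadd pf pg)).
have E := diffD (polyfun_differentiable x pf) (polyfun_differentiable x pg).
exact: (congr1 (fun h => h v) E).
Qed.

Lemma dfunM f g x v : polyfun f -> polyfun g ->
  dfun (fun y => f y * g y) x v = f x * dfun g x v + g x * dfun f x v.
Proof.
move=> pf pg; rewrite (dfun_diff _ _ pf) (dfun_diff _ _ pg) (dfun_diff _ _ (PFmul pf pg)).
have E := diffM (polyfun_differentiable x pf) (polyfun_differentiable x pg).
exact: (congr1 (fun h => h v) E).
Qed.

Lemma dfun_coord i x v : dfun (fun y => y ord0 i) x v = v ord0 i.
Proof.
rewrite dfun_diff; last exact: PFcoord.
(* The coordinate is bundled as a linear map so that [diff_lin] identifies it with its own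
   differential. *)
pose l : {linear pt R n -> (CC R)^o} :=
  HB.pack (fun y : pt R n => y ord0 i : (CC R)^o)
    (GRing.isLinear.Build _ _ _ _ _ (coord_linear i)).
rewrite -[X in 'd X _]/(l : _ -> _) diff_lin//.
exact: coord_continuous.
Qed.

Lemma dfun_comp f phi x v : polyfun f -> polymap phi ->
  dfun (f \o phi) x v = dfun f (phi x) (dmap phi x v).
Proof.
move=> pf pphi; rewrite (dfun_diff _ _ (polyfun_comp pf pphi)) (dfun_diff _ _ pf).
rewrite (dmap_diff _ _ pphi).
have E := diff_comp (polymap_differentiable x pphi)
                    (polyfun_differentiable (phi x) pf).
exact: (congr1 (fun h => h v) E).
Qed.

Lemma derivable_comp phi (gamma : (CC R)^o -> pt R n) (t : (CC R)^o) :
  polymap phi -> derivable gamma t 1 ->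
  derivable (phi \o gamma) t 1 /\
  (phi \o gamma)^`() t = dmap phi (gamma t) (gamma^`()%classic t).
Proof.
move=> pphi /derivable1_diffP dgamma.
have dphi := polymap_differentiable (gamma t) pphi.
have dc := differentiable_comp dgamma dphi.
split; first exact/derivable1_diffP.
rewrite !derive1E (deriveE _ dc) (deriveE _ dgamma) (dmap_diff _ _ pphi).
exact: (congr1 (fun h => h 1) (diff_comp dgamma dphi)).
Qed.

Lemma dmap_coord phi x v i : polymap phi ->
  dmap phi x v ord0 i = dfun (fun y => phi y ord0 i) x v.
Proof.
move=> pphi; rewrite -(dfun_coord i (phi x)).
by rewrite -(dfun_comp _ _ (PFcoord R i) pphi).
Qed.

Lemma dfun_sum f x v : polyfun f ->
  dfun f x v = \sum_(i < n) v ord0 i * dfun f x (delta_mx 0 i).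
Proof.
move=> pf; rewrite {1}[v]matrix_sum_delta big_ord1 dfun_diff// linear_sum /=.
by apply: eq_bigr => i _; rewrite linearZ dfun_diff.
Qed.

Lemma polyfun_dfun f nu : polyfun f -> polymap nu ->
  polyfun (fun x => dfun f x (nu x)).
Proof.
move=> pf pnu; elim: pf => [c|i|{}f g pf IHf pg IHg|{}f g pf IHf pg IHg].
- under eq_fun do rewrite dfun_const; exact: PFconst.
- under eq_fun do rewrite dfun_coord; exact: pnu.
- under eq_fun do rewrite dfunD//; exact: PFadd.
- by under eq_fun do rewrite dfunM//; apply: PFadd; apply: PFmul.
Qed.

Lemma vf_bracket_coord nu mu x i : polymap nu -> polymap mu ->
  vf_bracket nu mu x ord0 i =
  dfun (fun y => mu y ord0 i) x (nu x) - dfun (fun y => nu y ord0 i) x (mu x).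
Proof.
move=> pnu pmu; rewrite vf_bracketE -(dmap_coord _ _ _ pmu) -(dmap_coord _ _ _ pnu).
by move: (dmap mu _ _) (dmap nu _ _) => a b; rewrite !mxE.
Qed.

Lemma polymap_vf_bracket nu mu : polymap nu -> polymap mu ->
  polymap (vf_bracket nu mu).
Proof.
move=> pnu pmu i.
under eq_fun do rewrite vf_bracket_coord//.
by apply: PFadd; [|apply: polyfun_opp]; apply: polyfun_dfun.
Qed.

(** Induction on [f] replaces the symmetry of second derivatives: a coordinate gives back the
    definition of the bracket, and for a product the cross terms, symmetric in [nu] and [mu],
    cancel. *)
Lemma dfun_bracket f nu mu x : polyfun f -> polymap nu -> polymap mu ->
  dfun f x (vf_bracket nu mu x) =
  dfun (fun y => dfun f y (mu y)) x (nu x) - dfun (fun y => dfun f y (nu y)) x (mu x).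
Proof.
move=> pf pnu pmu; elim: pf => [c|i|{}f g pf IHf pg IHg|{}f g pf IHf pg IHg].
- have E eta v : dfun (fun y => dfun (fun=> c) y (eta y)) x v = 0.
    rewrite (_ : (fun y => _) = fun=> 0); first exact: dfun_const.
    by apply/funext => y; rewrite dfun_const.
  by rewrite (E mu (nu x)) (E nu (mu x)) dfun_const subrr.
- have E eta v : dfun (fun y : pt R n => dfun (fun z => z ord0 i) y (eta y)) x v
      = dfun (fun y => eta y ord0 i) x v.
    by rewrite (_ : (fun y => _) = fun y => eta y ord0 i)//; apply/funext => y;
      exact: dfun_coord.
  transitivity (vf_bracket nu mu x ord0 i); first exact: dfun_coord.
  transitivity (dfun (fun y => mu y ord0 i) x (nu x)
              - dfun (fun y => nu y ord0 i) x (mu x)); first exact: vf_bracket_coord.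
  by congr (_ - _); symmetry; exact: E.
- have P eta : polymap eta -> polyfun (fun y => dfun f y (eta y)) by exact: polyfun_dfun.
  have Q eta : polymap eta -> polyfun (fun y => dfun g y (eta y)) by exact: polyfun_dfun.
  have E eta v : polymap eta -> dfun (fun y => dfun (fun z => f z + g z) y (eta y)) x v
      = dfun (fun y => dfun f y (eta y)) x v + dfun (fun y => dfun g y (eta y)) x v.
    move=> peta; rewrite -(dfunD _ _ (P _ peta) (Q _ peta)).
    by congr dfun; apply/funext => y; rewrite dfunD.
  rewrite (E mu (nu x))// (E nu (mu x))// (dfunD _ _ pf pg) IHf IHg; ring.
- have P eta : polymap eta -> polyfun (fun y => dfun f y (eta y)) by exact: polyfun_dfun.
  have Q eta : polymap eta -> polyfun (fun y => dfun g y (eta y)) by exact: polyfun_dfun.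
  have E eta v : polymap eta -> dfun (fun y => dfun (fun z => f z * g z) y (eta y)) x v =
      (f x * dfun (fun y => dfun g y (eta y)) x v + dfun g x (eta x) * dfun f x v) +
      (g x * dfun (fun y => dfun f y (eta y)) x v + dfun f x (eta x) * dfun g x v).
    move=> peta.
    rewrite -(dfunM _ _ pf (Q _ peta)) -(dfunM _ _ pg (P _ peta)).
    rewrite -(dfunD _ _ (PFmul pf (Q _ peta)) (PFmul pg (P _ peta))).
    by congr dfun; apply/funext => y; rewrite dfunM.
  rewrite (E mu (nu x))// (E nu (mu x))// (dfunM _ _ pf pg) IHf IHg; ring.
Qed.

End Calculus.

(** * Push-forward of vector fields *)

Section VectorFields.
Context {R : realType} {n : nat} (X : set (pt R n)).
Implicit Types (f g : pt R n -> CC R) (phi psi nu mu : pt R n -> pt R n).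
Implicit Types (x v w : pt R n).

Lemma tangentP x v :
  tangent X x v <-> forall f, polyfun f -> vanishes_on X f -> dfun f x v = 0.
Proof. by rewrite dfunE. Qed.

Lemma tangent_lin x a v w : tangent X x v -> tangent X x w ->
  tangent X x (a *: v + w).
Proof.
move=> /tangentP tv /tangentP tw; apply/tangentP => f pf f0.
by rewrite dfun_lin// tv// tw// mulr0 addr0.
Qed.

Lemma tangent0 x : tangent X x 0.
Proof.
by apply/tangentP => f pf _; rewrite (dfun_diff _ _ pf) linear0.
Qed.

(** The difference of [f] and [g] vanishes on [X], so tangent vectors kill it. This allows
    differentiating identities valid on [X] only, such as [psi (phi y) = y]. *)
Lemma dfun_eq_on f g x v : polyfun f -> polyfun g -> tangent X x v ->
  (forall y, X y -> f y = g y) -> dfun f x v = dfun g x v.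
Proof.
move=> pf pg /tangentP tv fg; apply/eqP; rewrite -subr_eq0 -mulN1r; apply/eqP.
rewrite -(tv (fun y => f y + (-1) * g y)).
- rewrite (dfunD _ _ pf (PFmul (PFconst n (-1)) pg)).
  rewrite (dfunM _ _ (PFconst n (-1)) pg) dfun_const; ring.
- by apply: PFadd => //; apply: PFmul => //; exact: PFconst.
- by move=> y Xy; rewrite fg// mulN1r subrr.
Qed.

Lemma alg_vfD nu mu : alg_vf X nu -> alg_vf X mu ->
  alg_vf X (fun x => nu x + mu x).
Proof.
move=> [pnu tnu] [pmu tmu]; split=> [i|x Xx].
  by under eq_fun do rewrite mxE; apply: PFadd; [exact: pnu|exact: pmu].
by rewrite -[nu x]scale1r; apply: tangent_lin; [exact: tnu|exact: tmu].
Qed.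

Lemma alg_vfZ f nu : polyfun f -> alg_vf X nu -> alg_vf X (fun x => f x *: nu x).
Proof.
move=> pf [pnu tnu]; split=> [i|x Xx].
  by under eq_fun do rewrite mxE; apply: PFmul => //; exact: pnu.
rewrite -[_ *: _]addr0; apply: tangent_lin; [exact: tnu|exact: tangent0].
Qed.

(** If [f] vanishes on [X], so do its derivatives along [nu] and [mu]; tangency then kills both
    terms of the commutator in [dfun_bracket]. *)
Lemma alg_vf_bracket nu mu : alg_vf X nu -> alg_vf X mu ->
  alg_vf X (vf_bracket nu mu).
Proof.
move=> [pnu tnu] [pmu tmu]; split; first exact: polymap_vf_bracket.
move=> x Xx; apply/tangentP => f pf f0; rewrite dfun_bracket//.
have v0 eta : alg_vf X eta -> vanishes_on X (fun y => dfun f y (eta y)).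
  by move=> [_ teta] y Xy; exact: (iffLR (tangentP _ _) (teta y Xy)).
rewrite (iffLR (tangentP _ _) (tnu x Xx) _ (polyfun_dfun pf pmu)) ?sub0r; last exact: v0.
by rewrite (iffLR (tangentP _ _) (tmu x Xx) _ (polyfun_dfun pf pnu)) ?oppr0//; exact: v0.
Qed.

Lemma Lie_alg_alg_vf nu : Lie_alg X nu -> alg_vf X nu.
Proof.
elim=> {nu}[nu []//|nu mu _ + _|c nu _|nu mu _ + _|//].
- exact: alg_vfD.
- exact/alg_vfZ/PFconst.
- exact: alg_vf_bracket.
Qed.

(** The inverse is an explicit datum because push-forwards are built from it; it inverts [phi] on
    [X] only. *)
Definition aut_pair phi psi : Prop :=
  [/\ polymap phi, polymap psi &
      forall x, X x -> [/\ X (phi x), X (psi x), psi (phi x) = x & phi (psi x) = x]].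

Lemma alg_autP phi : alg_aut X phi -> exists psi, aut_pair phi psi.
Proof.
move=> [pphi [Xphi [psi [ppsi [Xpsi [K1 K2]]]]]]; exists psi; split=> // x Xx.
by split; [exact: Xphi|exact: Xpsi|exact: K1|exact: K2].
Qed.

Lemma aut_pair_sym phi psi : aut_pair phi psi -> aut_pair psi phi.
Proof. by move=> [? ? H]; split=> // x /H[]. Qed.

Definition vf_pushforward phi psi nu x := dmap phi (psi x) (nu (psi x)).

Section Pushforward.
Context {phi psi : pt R n -> pt R n} (phiP : aut_pair phi psi).

Lemma polymap_pushforward nu : polymap nu -> polymap (vf_pushforward phi psi nu).
Proof.
case: phiP => pphi ppsi _ pnu i.
under eq_fun do rewrite /vf_pushforward dmap_coord//.
exact: (polyfun_comp (polyfun_dfun (pphi i) pnu) ppsi).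
Qed.

Lemma dfun_pushforward f nu x : polyfun f -> X x ->
  dfun f x (vf_pushforward phi psi nu x) = dfun (f \o phi) (psi x) (nu (psi x)).
Proof.
case: phiP => pphi ppsi H pf /H[_ _ _ E].
by rewrite (dfun_comp _ _ pf pphi) E.
Qed.

Lemma tangent_dmap x v : X x -> tangent X x v -> tangent X (phi x) (dmap phi x v).
Proof.
case: phiP => pphi ppsi H Xx /tangentP tv; apply/tangentP => f pf f0.
rewrite -(dfun_comp _ _ pf pphi) tv//; first exact: polyfun_comp.
by move=> y /H[Xy _ _ _]; exact: f0.
Qed.

Lemma alg_vf_pushforward nu : alg_vf X nu -> alg_vf X (vf_pushforward phi psi nu).
Proof.
move=> [pnu tnu]; split; first exact: polymap_pushforward.
move=> x Xx; case: phiP => _ _ /(_ x Xx)[_ Xy _ E]; rewrite -{1}E.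
by apply: tangent_dmap => //; exact: tnu.
Qed.

Lemma pushforward_bracket nu mu : alg_vf X nu -> alg_vf X mu ->
  eq_on X (vf_bracket (vf_pushforward phi psi nu) (vf_pushforward phi psi mu))
    (vf_pushforward phi psi (vf_bracket nu mu)).
Proof.
move=> vnu vmu x Xx; apply/rowP => i.
have [pphi ppsi H] := phiP; have [_ Xy _ _] := H x Xx.
have [pnu tnu] := vnu; have [pmu tmu] := vmu.
(* Composed with [phi], the [i]-th coordinate of the push-forward of [theta] agrees on [X] with the
   derivative of [phi_i] along [theta]. As [eta] is tangent, [dfun_eq_on] applies. *)
have E eta theta : alg_vf X eta -> alg_vf X theta ->
    dfun (fun z => vf_pushforward phi psi theta z ord0 i) x (vf_pushforward phi psi eta x) =
    dfun (fun z => dfun (fun u => phi u ord0 i) z (theta z)) (psi x) (eta (psi x)).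
  move=> [peta teta] [ptheta ttheta].
  have pp := polymap_pushforward ptheta i.
  rewrite (dfun_pushforward _ pp Xx); apply: dfun_eq_on.
  - exact: (polyfun_comp pp pphi).
  - exact: (polyfun_dfun (pphi i) ptheta).
  - exact: teta.
  - by move=> z /H[_ _ zE _]; rewrite /vf_pushforward /= zE dmap_coord.
rewrite (vf_bracket_coord _ _ (polymap_pushforward pnu) (polymap_pushforward pmu)).
rewrite {2}/vf_pushforward (dmap_coord _ _ _ pphi) (dfun_bracket _ (pphi i) pnu pmu).
by rewrite -(E nu mu)// -(E mu nu).
Qed.

(** [phi] maps the integral curve of [nu] through [psi x] to one of the push-forward through [x]. *)
Lemma compl_integrable_pushforward nu :
  compl_integrable X nu -> compl_integrable X (vf_pushforward phi psi nu).
Proof.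
move=> [vnu flow]; split; first exact: alg_vf_pushforward.
move=> x Xx; have [pphi ppsi H] := phiP; have [_ Xy _ xE] := H x Xx.
have [gamma [g0 gP]] := flow _ Xy; exists (phi \o gamma); split.
  by rewrite /= g0 xE.
move=> t; have [Xg [dg gE]] := gP t; have [Xpg _ gK _] := H _ Xg.
have [dpg pgE] := derivable_comp pphi dg.
by rewrite pgE gE /vf_pushforward /= gK.
Qed.

(** Push-forward commutes with sums and multiples everywhere, and with brackets on [X], which
    suffices thanks to [LAeq]. *)
Lemma Lie_alg_pushforward nu : Lie_alg X nu -> Lie_alg X (vf_pushforward phi psi nu).
Proof.
have [pphi ppsi H] := phiP.
elim=> {nu} [nu cnu|nu mu _ IHnu _ IHmu|c nu _ IHnu|nu mu Lnu IHnu Lmu IHmu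
            |nu mu Lnu IHnu vmu nm].
- exact/LAci/compl_integrable_pushforward.
- rewrite (_ : vf_pushforward _ _ _ =
      fun x => vf_pushforward phi psi nu x + vf_pushforward phi psi mu x).
    exact: LAadd.
  apply/funext => x; rewrite /vf_pushforward -[nu _]scale1r dmap_lin//.
  by rewrite !scale1r.
- rewrite (_ : vf_pushforward _ _ _ = fun x => c *: vf_pushforward phi psi nu x).
    exact: LAscale.
  by apply/funext => x; rewrite /vf_pushforward !(dmap_diff _ _ pphi) linearZ.
- have vnu := Lie_alg_alg_vf Lnu; have vmu := Lie_alg_alg_vf Lmu.
  apply: (LAeq (LAbracket IHnu IHmu)); last exact: pushforward_bracket.
  exact/alg_vf_pushforward/alg_vf_bracket.
- apply: (LAeq IHnu); first exact: alg_vf_pushforward.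
  by move=> x /H[_ Xy _ _]; rewrite /vf_pushforward nm.
Qed.

End Pushforward.

(* The largest submodule contained in [Lie_alg X]. *)
Definition max_submodule : set (pt R n -> pt R n) := fun nu =>
  alg_vf X nu /\ forall f, polyfun f -> Lie_alg X (fun x => f x *: nu x).

Lemma max_submodule_Lie_alg nu : max_submodule nu -> Lie_alg X nu.
Proof.
move=> [_ /(_ (fun=> 1) (PFconst n 1))].
by under eq_fun do rewrite scale1r.
Qed.

Lemma sub_max_submodule (L : set (pt R n -> pt R n)) :
  vf_submodule X L -> (forall nu, L nu -> Lie_alg X nu) -> L `<=` max_submodule.
Proof.
move=> [vL _ _ LZ _] LL nu Lnu; split; first exact: vL.
by move=> f pf; exact/LL/LZ.
Qed.

Lemma max_submodule_vf_submodule (L : set (pt R n -> pt R n)) :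
  vf_submodule X L -> (forall nu, L nu -> Lie_alg X nu) ->
  vf_submodule X max_submodule.
Proof.
move=> LX LL; split.
- by move=> nu [].
(* [Lie_alg] has no constructor for the zero field; here it comes from [L]. *)
- by apply: (sub_max_submodule LX LL); case: LX.
- move=> nu mu [vnu Lnu] [vmu Lmu]; split; first exact: alg_vfD.
  move=> f pf; under eq_fun do rewrite scalerDr.
  by apply: LAadd; [exact: Lnu|exact: Lmu].
- move=> f nu pf [vnu Lnu]; split; first exact: alg_vfZ.
  move=> g pg; under eq_fun do rewrite scalerA.
  exact/Lnu/PFmul.
- move=> nu mu [vnu Lnu] vmu nm; split=> // f pf.
  apply: LAeq (Lnu f pf) (alg_vfZ pf vmu) _.
  by move=> x Xx; rewrite nm.
Qed.

(** On [X], [f] times the push-forward of [nu] is the push-forward of [(f \o phi) nu], and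
    [f \o phi] is again polynomial. *)
Lemma max_submodule_pushforward phi psi nu : aut_pair phi psi ->
  max_submodule nu -> max_submodule (vf_pushforward phi psi nu).
Proof.
move=> phiP [vnu Lnu]; have [pphi ppsi H] := phiP.
split; first exact: alg_vf_pushforward.
move=> f pf; have L := Lie_alg_pushforward phiP (Lnu _ (polyfun_comp pf pphi)).
apply: LAeq L _ _; first exact/alg_vfZ/alg_vf_pushforward.
move=> x /H[_ _ _ xE].
by rewrite /vf_pushforward !(dmap_diff _ _ pphi) linearZ /= xE.
Qed.

End VectorFields.

(** * Weak Nullstellensatz *)

(** Countability would pass to the real unit interval, which has Lebesgue measure 1, not 0. *)
Lemma complex_uncountable (R : realType) : ~ countable [set: CC R].
Proof.
move=> /countable_injP[f finj].
have : countable (`[0, 1]%classic : set R).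
  apply/countable_injP; exists (fun x => f x%:C%C) => x y _ _ /finj.
  by rewrite !in_setE => /(_ I I)[].
move=> /countable_lebesgue_measure0; rewrite lebesgue_measure_itv /= lte_fin ltr01.
by move=> /eqP; rewrite oppr0 adde0 eqe oner_eq0.
Qed.

Section Nullstellensatz.
Context {R : realType} {n : nat}.
Implicit Types (f g h : pt R n -> CC R) (J : (pt R n -> CC R) -> Prop).

(** Monomials are words in the variables: multiplication is concatenation, and finite lists of words
    form a countable type. *)
Definition monomial (s : seq 'I_n) (x : pt R n) : CC R := \prod_(i <- s) x ord0 i.

Lemma polyfun_monomials f : polyfun f ->
  exists r : seq (CC R * seq 'I_n),
    f = fun x => \sum_(p <- r) p.1 * monomial p.2 x.
Proof.
elim=> [c|i|{}f g _ [r ->] _ [s ->]|{}f g _ [r ->] _ [s ->]].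
- exists [:: (c, [::])]; apply/funext => x.
  by rewrite big_seq1 /monomial big_nil mulr1.
- exists [:: (1, [:: i])]; apply/funext => x.
  by rewrite big_seq1 /monomial big_seq1 mul1r.
- by exists (r ++ s); apply/funext => x; rewrite big_cat.
- exists [seq (p.1 * q.1, p.2 ++ q.2) | p <- r, q <- s]; apply/funext => x.
  rewrite big_allpairs_dep mulr_suml; apply: eq_bigr => p _.
  rewrite mulr_sumr; apply: eq_bigr => q _ /=.
  by rewrite /monomial big_cat mulrACA.
Qed.

Lemma polyfun_monomial_span f : polyfun f ->
  exists (S : seq (seq 'I_n)) (c : 'rV[CC R]_(size S)),
    f = fun x => \sum_(j < size S) c ord0 j * monomial (nth [::] S j) x.
Proof.
move=> /polyfun_monomials[r ->]; exists (map snd r).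
exists (\row_j (nth (0, [::]) r j).1); apply/funext => x.
rewrite (big_nth (0, [::])) big_mkord size_map; apply: eq_bigr => j _.
by rewrite mxE (nth_map (0, [::])).
Qed.

Lemma row_dependent (K : fieldType) d (A : 'M[K]_(d.+1, d)) :
  exists2 u : 'rV_d.+1, u != 0 & u *m A = 0.
Proof.
have /rowV0Pn[u /sub_kermxP uA u0] : kermx A != 0.
  by rewrite kermx_eq0 /row_free neq_ltn ltnS rank_leq_col.
by exists u.
Qed.

(* Pigeonhole: the finite-dimensional spaces spanned by finitely many monomials are
   countably many, whereas the index set is not countable. *)
Lemma uncountable_family_dependent (h : CC R -> pt R n -> CC R) :
  (forall a, polyfun (h a)) ->
  exists (d : nat) (a : 'I_d -> CC R) (u : 'I_d -> CC R),
    [/\ injective a, exists k, u k != 0 &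
        forall x, \sum_(k < d) u k * h (a k) x = 0].
Proof.
move=> ph.
(* [A S] holds the parameters [a] for which [h a] lies in the span of the monomials in [S]. These
   countably many sets cover [CC R], so one is infinite. *)
pose A (S : seq (seq 'I_n)) : set (CC R) := [set a |
  exists c : 'rV[CC R]_(size S),
    h a = fun x => \sum_(j < size S) c ord0 j * monomial (nth [::] S j) x].
have [S SA] : exists S, infinite_set (A S).
  apply: contrapT => /forallNP fA; apply: (@complex_uncountable R).
  rewrite (_ : setT = \bigcup_(S in setT) A S).
    apply: bigcup_countable => [|S _]; first exact: countableP.
    by apply: finite_set_countable; apply: contrapT; exact: fA.
  apply/seteqP; split=> // a _.
  by have [S [c E]] := polyfun_monomial_span (ph a); exists S => //; exists c.
have [B BA sB] := infinite_set_fset (size S).+1 SA.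
pose a (k : 'I_(size S).+1) := nth 0 (enum_fset B) k.
have lt_k (k : 'I_(size S).+1) : (k < size (enum_fset B))%N.
  exact: leq_trans (ltn_ord k) sB.
have aA k : A S (a k) by apply: BA; exact: mem_nth.
have [c cE] := choice aA.
(* There are [size S + 1] distinct parameters and only [size S] coefficients for each. *)
have [u u0 uc] := row_dependent (\matrix_(k, j) c k ord0 j).
exists _, a, (u ord0); split.
- move=> k l /eqP; rewrite nth_uniq ?lt_k ?fset_uniq// => /eqP.
  exact: val_inj.
- by have /rV0Pn := u0.
- move=> x; under eq_bigr do rewrite cE mulr_sumr.
  rewrite exchange_big big1//= => j _; under eq_bigr do rewrite mulrA.
  rewrite -mulr_suml (_ : \sum_k _ = (u *m \matrix_(k, j) c k ord0 j) ord0 j).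
    by rewrite uc mxE mul0r.
  by rewrite mxE; apply: eq_bigr => k _; rewrite mxE.
Qed.

Definition polyideal J : Prop :=
  [/\ forall f, J f -> polyfun f, J (fun=> 0),
      forall f g, J f -> J g -> J (fun x => f x + g x) &
      forall f g, polyfun f -> J g -> J (fun x => f x * g x)].

Lemma polyideal_sum J (I : Type) (r : seq I) (F : I -> pt R n -> CC R) :
  polyideal J -> (forall i, J (F i)) -> J (fun x => \sum_(i <- r) F i x).
Proof.
move=> [_ J0 JD _] JF; elim: r => [|i r IH].
  by under eq_fun do rewrite big_nil.
by under eq_fun do rewrite big_cons; exact: JD.
Qed.

Lemma polyfun_horner (p : {poly CC R}) (i : 'I_n) : polyfun (fun x => p.[x ord0 i]).
Proof.
elim/poly_ind: p => [|p c pp].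
  by under eq_fun do rewrite horner0; exact: PFconst.
under eq_fun do rewrite hornerMXaddC.
by apply: PFadd; [apply: PFmul => //; exact: PFcoord|exact: PFconst].
Qed.

(** By hypothesis every [x_i - a] is invertible modulo [J], with inverse [h a]. Clearing
    denominators in a linear relation among the [h a] puts a nonzero polynomial in [x_i] into [J];
    its linear factors are then cancelled one by one. *)
Lemma polyideal_coord J i : polyideal J ->
  (forall a : CC R, exists h, polyfun h /\ J (fun x => h x * (x ord0 i - a) - 1)) ->
  J (fun=> 1).
Proof.
move=> iJ H; have [Jp J0 JD JM] := iJ.
have [h hP] := choice H.
have ph a : polyfun (h a) by have [] := hP a.
have Jh a : J (fun x => h a x * (x ord0 i - a) - 1) by have [] := hP a.
have [d [a [u [ainj [k0 uk0] dep]]]] := uncountable_family_dependent ph.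
pose q k : {poly CC R} := \prod_(l < d | l != k) ('X - (a l)%:P).
pose p : {poly CC R} := \sum_k u k *: q k.
have qE k y : (q k).[y] = \prod_(l < d | l != k) (y - a l).
  by rewrite horner_prod; apply: eq_bigr => l _; rewrite hornerXsubC.
(* At [a k0] every [q k] with [k != k0] vanishes, while [q k0] does not since [a] is injective. *)
have p0 : p != 0.
  apply: contraNneq uk0 => p0; have : p.[a k0] = 0 by rewrite p0 horner0.
  rewrite horner_sum (bigD1 k0)//= big1 ?addr0 => [|k kk0].
    rewrite hornerZ qE => /eqP; rewrite mulf_eq0 => /orP[//|].
    rewrite prodf_seq_eq0 => /hasP[l _ /andP[lk0]]; rewrite subr_eq0 => /eqP /ainj E.
    by rewrite E eqxx in lk0.
  by rewrite hornerZ qE (bigD1 k0) ?(eq_sym k0)//= subrr mul0r mulr0.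
have Jpi : J (fun x => p.[x ord0 i]).
  (* The right-hand side is [p] minus the relation [\sum_k u k * h (a k)], which is zero, times the
     product of all [x_i - a l]. *)
  rewrite (_ : (fun x => _) = fun x : pt R n =>
      \sum_(k < d) (- (u k * (q k).[x ord0 i])) * (h (a k) x * (x ord0 i - a k) - 1)).
    apply: polyideal_sum => // k; apply: (JM (fun x : pt R n => - (u k * (q k).[x ord0 i]))) => //.
    by apply/polyfun_opp/PFmul; [exact: PFconst|exact: polyfun_horner].
  apply/funext => x; apply/eqP; rewrite -subr_eq0; apply/eqP.
  rewrite horner_sum -sumrB.
  transitivity ((\sum_(k < d) u k * h (a k) x) * \prod_(l < d) (x ord0 i - a l)).
    rewrite mulr_suml; apply: eq_bigr => k _.
    by rewrite hornerZ qE [\prod_(l < d) _](bigD1 k)//=; ring.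
  by rewrite dep mul0r.
have [r pE] := closed_field_poly_normal p.
have /(JM (fun=> (lead_coef p)^-1)) Jr : J (fun x => p.[x ord0 i]) by [].
have {}Jr : J (fun x => 1 * \prod_(z <- r) (x ord0 i - z)).
  rewrite (_ : (fun x => _) = fun x : pt R n => (lead_coef p)^-1 * p.[x ord0 i]).
    by apply: Jr; exact: PFconst.
  apply/funext => x; rewrite {2}pE hornerZ mulKf ?lead_coef_eq0// mul1r horner_prod.
  by apply: eq_bigr => z _; rewrite hornerXsubC.
have cancel_root g z : polyfun g -> J (fun x => g x * (x ord0 i - z)) -> J g.
  move=> pg Jg.
  rewrite (_ : g = fun x => h z x * (g x * (x ord0 i - z))
                          + (- g x) * (h z x * (x ord0 i - z) - 1)).
    apply: (JD (fun x => h z x * (g x * (x ord0 i - z)))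
               (fun x => (- g x) * (h z x * (x ord0 i - z) - 1))); first exact: JM.
    by apply: JM => //; exact: polyfun_opp.
  by apply/funext => x; ring.
elim/last_ind: r {pE} Jr => [|r z IH].
  by under eq_fun do rewrite big_nil mulr1.
under eq_fun do rewrite -cats1 big_cat big_seq1 /= mulrA.
move=> /cancel_root Jz; apply/IH/Jz/PFmul; first exact: PFconst.
by apply: polyfun_prod => c; apply: PFadd; [exact: PFcoord|exact: PFconst].
Qed.

(** If adjoining [x_i - a] to [J] gave the unit ideal for every [a], each [x_i - a] would be
    invertible modulo [J], against [polyideal_coord]. *)
Lemma polyideal_add_coord J i : polyideal J -> ~ J (fun=> 1) ->
  exists a J', [/\ polyideal J', ~ J' (fun=> 1), forall f, J f -> J' f &
                   J' (fun x => x ord0 i - a)].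
Proof.
move=> iJ J1; have [Jp J0 JD JM] := iJ.
pose J' a f := polyfun f /\
  exists2 h, polyfun h & J (fun x => f x + h x * (x ord0 i - a)).
have [a Ja] : exists a, ~ J' a (fun=> 1).
  apply: contrapT => /forallNP H; apply/J1/(@polyideal_coord J i iJ) => a.
  have [_ [h ph Jh]] := contrapT (H a).
  exists (fun x => - h x); split; first exact: polyfun_opp.
  rewrite (_ : (fun x => _) = fun x : pt R n => (-1) * (1 + h x * (x ord0 i - a))).
    by apply: (JM (fun=> -1)) => //; exact: PFconst.
  by apply/funext => x; ring.
exists a, (J' a); split=> //.
- split.
  + by move=> f [].
  + split; first exact: PFconst.
    exists (fun=> 0); first exact: PFconst.
    by under eq_fun do rewrite mul0r addr0.
  + move=> f g [pf [h ph Jh]] [pg [k pk Jk]]; split; first exact: PFadd.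
    exists (fun x => h x + k x); first exact: PFadd.
    rewrite (_ : (fun x => _) = fun x : pt R n => (f x + h x * (x ord0 i - a))
                                       + (g x + k x * (x ord0 i - a))).
      exact: JD Jh Jk.
    by apply/funext => x; ring.
  + move=> f g pf [pg [k pk Jk]]; split; first exact: PFmul.
    exists (fun x => f x * k x); first exact: PFmul.
    rewrite (_ : (fun x => _) = fun x : pt R n => f x * (g x + k x * (x ord0 i - a))).
      exact: JM pf Jk.
    by apply/funext => x; ring.
- move=> f Jf; split; first exact: Jp.
  exists (fun=> 0); first exact: PFconst.
  by under eq_fun do rewrite mul0r addr0.
- split; first by apply: PFadd; [exact: PFcoord|exact: PFconst].
  exists (fun=> -1); first exact: PFconst.
  by under eq_fun do rewrite mulN1r subrr.
Qed.

(** Treating the coordinates in turn enlarges [J] to a proper ideal containing some [x_i - a_i] for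
    each [i]. Modulo it every [f] equals the constant [f(a)], so a nonzero value at [a] of some [f]
    in [J] would put 1 into it. *)
Theorem weak_nullstellensatz J : polyideal J -> ~ J (fun=> 1) ->
  exists x, forall f, J f -> f x = 0.
Proof.
move=> iJ J1.
have [J' [iJ' J'1 JJ' J'a]] : exists J', [/\ polyideal J', ~ J' (fun=> 1),
    forall f, J f -> J' f &
    forall i, i \in enum 'I_n -> exists a, J' (fun x => x ord0 i - a)].
  elim: (enum 'I_n) => [|i s [J' [iJ' J'1 JJ' H]]]; first by exists J.
  have [a [J'' [? ? J'J'' J''a]]] := polyideal_add_coord i iJ' J'1.
  exists J''; split=> //; first by move=> f /JJ'; exact: J'J''.
  move=> j; rewrite in_cons => /orP[/eqP->|/H[b /J'J'']]; first by exists a.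
  by exists b.
have [a aP] := choice (fun i => J'a i (mem_enum _ i)).
have [J'p J'0 J'D J'M] := iJ'; exists (\row_i a i).
have eval f : polyfun f -> J' (fun x => f x - f (\row_i a i)).
  elim=> [c|i|{}f g pf IHf pg IHg|{}f g pf IHf pg IHg].
  - by under eq_fun do rewrite subrr.
  - by rewrite mxE.
  - under eq_fun do rewrite opprD addrACA.
    exact: J'D IHf IHg.
  - set y := \row_i a i.
    rewrite (_ : (fun x => _) = fun x : pt R n => f x * (g x - g y) + g y * (f x - f y)).
      apply: (J'D (fun x => f x * (g x - g y)) (fun x => g y * (f x - f y))).
        exact: J'M.
      by apply: (J'M (fun=> g y)) => //; exact: PFconst.
    by apply/funext => x; ring.
move=> f Jf; apply: contrapT => /eqP fa; apply: J'1.
set y := \row_i a i in fa eval *.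
rewrite (_ : (fun x => _) = fun x : pt R n => (f y)^-1 * (f x + (-1) * (f x - f y))).
  apply: (J'M (fun=> (f y)^-1)); first exact: PFconst.
  apply: (J'D f (fun x => (-1) * (f x - f y))); first exact: JJ'.
  apply: (J'M (fun=> -1)); [exact: PFconst|exact/eval/J'p/JJ'].
by apply/funext => x; rewrite mulN1r opprB addrC subrK mulVf.
Qed.

End Nullstellensatz.

(** * Submodules with full fibers *)

(** A finite family in [W] of maximal rank works: adjoining any further [w] of [W] cannot raise the
    rank. *)
Lemma finite_row_span (F : fieldType) n (W : 'rV[F]_n -> Prop) :
  exists m (B : 'M[F]_(m, n)), (forall i, W (row i B)) /\ forall w, W w -> (w <= B)%MS.
Proof.
pose P r := `[< exists m (B : 'M[F]_(m, n)), (forall i, W (row i B)) /\ \rank B = r >].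
have P0 : exists r, P r.
  by exists 0%N; apply/asboolP; exists 0%N, 0; split; [case|rewrite mxrank0].
have Pn r : P r -> (r <= n)%N by move=> /asboolP[m [B [_ <-]]]; exact: rank_leq_col.
case: (ex_maxnP P0 Pn) => r /asboolP[m [B [WB rB]]] rmax.
exists m, B; split=> // w Ww.
have BC : (B <= col_mx w B)%MS by rewrite -addsmxE addsmxSr.
have : (\rank (col_mx w B) <= \rank B)%N.
  rewrite rB; apply: rmax; apply/asboolP; exists (1 + m)%N, (col_mx w B); split=> // i.
  case: (split_ordP i) => j ->.
    by rewrite rowKu ord1 row_id.
  by rewrite rowKd.
rewrite (geq_leqif (mxrank_leqif_sup BC)) col_mx_sub => /andP[]//.
Qed.

(** * Characteristic polynomials of matrices with polynomial entries *)

Section Determinant.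
Context {R : realType} {n : nat}.

Lemma polyfun_coefM (p q : pt R n -> {poly CC R}) :
  (forall k, polyfun (fun y => (p y)`_k)) -> (forall k, polyfun (fun y => (q y)`_k)) ->
  forall k, polyfun (fun y => (p y * q y)`_k).
Proof.
move=> pp pq k; under eq_fun do rewrite coefM.
by apply: polyfun_sum => i; apply: PFmul.
Qed.

Lemma polyfun_char_poly m (E : pt R n -> 'M[CC R]_m) k :
  (forall i j, polyfun (fun y => E y i j)) -> polyfun (fun y => (char_poly (E y))`_k).
Proof.
move=> pE; rewrite /char_poly /determinant.
under eq_fun do rewrite coef_sum.
apply: polyfun_sum => s; move: k; apply: polyfun_coefM => [k|]; first exact: PFconst.
elim: (index_enum _) => [|i r IH] k.
  by under eq_fun do rewrite big_nil; exact: PFconst.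
under eq_fun do rewrite big_cons; move: k; apply: polyfun_coefM => // k.
under eq_fun do rewrite !mxE coefB coefC.
apply: PFadd; first exact: PFconst.
by apply: polyfun_opp; case: eqP => _ //; exact: PFconst.
Qed.

End Determinant.

Section FullFibers.
Context {R : realType}.

Lemma vf_submodule_sum n (X : set (pt R n)) M (I : Type) (r : seq I)
    (F : I -> pt R n -> pt R n) : vf_submodule X M -> (forall i, M (F i)) ->
  M (fun x => \sum_(i <- r) F i x).
Proof.
move=> [_ M0 MD _ _] MF; elim: r => [|i r IH].
  by under eq_fun do rewrite big_nil.
by under eq_fun do rewrite big_cons; exact: MD.
Qed.

(* [E y] acts on vector fields, maps them all into [M], and is the identity at [x];
   the constant coefficient of its characteristic polynomial is the wanted multiplier by
   Cayley-Hamilton. *)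
Lemma full_fiber_local n (X : set (pt R n)) M nu x :
  vf_submodule X M -> alg_vf X nu ->
  (forall w, tangent X x w -> exists mu, M mu /\ mu x = w) ->
  exists f, [/\ polyfun f, f x != 0 & M (fun y => f y *: nu y)].
Proof.
(* Dimension zero is separated because square matrices form a ring only in size [n.+1]; there all
   fields are zero. *)
case: n => [|n] in X M nu x *.
  move=> [_ M0 _ _ _] _ _; exists (fun=> 1); split; [exact: PFconst|exact: oner_neq0|].
  by rewrite (_ : (fun y => _) = fun=> 0)//; apply/funext => y; exact: thinmx0.
move=> sM vnu fib; have [vM M0 MD MZ Meq] := sM.
pose e i : pt R n.+1 := delta_mx 0 i.
(* Finitely many equations of [X] whose gradients at [x] span the gradients of all of them, so that
   the kernel [K] below consists of tangent vectors. *)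
have [m [B [WB BW]]] := finite_row_span (fun w : 'rV[CC R]_n.+1 =>
  exists f, [/\ polyfun f, vanishes_on X f & w = \row_i dfun f x (e i)]).
have [f fP] := choice WB.
pose G y := \matrix_(i < n.+1, j < m) dfun (f j) y (e i).
have GE y v : v *m G y = \row_j dfun (f j) y v.
  apply/rowP => j; rewrite !mxE; have [pf _ _] := fP j.
  by rewrite (dfun_sum _ _ pf); apply: eq_bigr => i _; rewrite mxE.
have GB : G x = B^T.
  apply/matrixP => i j; rewrite !mxE; have [_ _ E] := fP j.
  by transitivity (row j B ord0 i); [rewrite E mxE|rewrite mxE].
have etaG eta y : alg_vf X eta -> X y -> eta y *m G y = 0.
  move=> [_ teta] Xy; rewrite GE; apply/rowP => j; rewrite !mxE.
  by have [pf f0 _] := fP j; exact: (iffLR (tangentP _ _ _) (teta y Xy)).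
pose K := kermx (G x).
have tK i : tangent X x (row i K).
  apply/tangentP => g pg g0.
  have /submxP[D DE] : (\row_i dfun g x (e i) <= B)%MS by apply: BW; exists g.
  rewrite (dfun_sum _ _ pg).
  transitivity ((row i K *m (\row_i dfun g x (e i))^T) ord0 ord0).
    by rewrite mxE; apply: eq_bigr => k _; rewrite !mxE.
  by rewrite DE trmx_mul -GB mulmxA -row_mul mulmx_ker row0 mul0mx mxE.
have [mu muP] := choice (fun i => fib _ (tK i)).
pose A y := \matrix_(i < n.+1, j < n.+1) mu i y ord0 j.
have Ax : A x = K.
  by apply/matrixP => i j; rewrite mxE; have [_ ->] := muP i; rewrite mxE.
(* Since [G x *m C *m G x = G x], the rows of [1 - G x *m C] lie in [K]; hence [U *m K] equals this
   matrix and [E x = 1]. *)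
pose C := pinvmx (G x); pose U := (1%:M - G x *m C) *m pinvmx K.
pose E y : 'M[CC R]_n.+1 := G y *m C + U *m A y.
have Ex : E x = 1.
  rewrite /E Ax /U mulmxKpV ?subrKC// sub_kermx mulmxBl mul1mx.
  by rewrite mulmxKpV ?subrr// submx_refl.
have pE i j : polyfun (fun y => E y i j).
  under eq_fun do rewrite /E !mxE.
  apply: PFadd; apply: polyfun_sum => k.
    under eq_fun do rewrite mxE; apply: PFmul; last exact: PFconst.
    have [pf _ _] := fP k.
    by apply: (polyfun_dfun (nu := fun=> e i)) => // l; exact: PFconst.
  under eq_fun do rewrite mxE; apply: PFmul; first exact: PFconst.
  have [/vM[pmu _] _] := muP k.
  by rewrite /A; under eq_fun do rewrite mxE; exact: pmu.
(* On [X] the term [eta G C] vanishes, leaving [eta U A], a combination of the [mu i] with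
   polynomial coefficients. *)
have stab eta : alg_vf X eta -> M (fun y => eta y *m E y).
  move=> veta; have [peta teta] := veta.
  have Ms : M (fun y => \sum_i (eta y *m U) ord0 i *: mu i y).
    apply: vf_submodule_sum sM _ => i.
    apply: (MZ (fun y => (eta y *m U) ord0 i)); last by have [] := muP i.
    under eq_fun do rewrite mxE; apply: polyfun_sum => k.
    by apply: PFmul; [exact: peta|exact: PFconst].
  have sE y : X y -> \sum_i (eta y *m U) ord0 i *: mu i y = eta y *m E y.
    move=> Xy; rewrite /E mulmxDr mulmxA etaG// mul0mx add0r [RHS]mulmxA.
    rewrite [RHS]mulmx_sum_row; apply: eq_bigr => i _; congr (_ *: _).
    by apply/rowP => j; rewrite !mxE.
  apply: (Meq _ _ Ms _ sE); split=> [i|y Xy].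
    by under eq_fun do rewrite mxE; apply: polyfun_sum => k; apply: PFmul.
  by rewrite -sE//; have [_] := vM _ Ms; exact.
have powM k : M (fun y => nu y *m E y ^+ k.+1).
  elim: k => [|k IH]; first by under eq_fun do rewrite expr1; exact: stab.
  under eq_fun do rewrite exprSr -mulmxE mulmxA.
  exact/(stab (fun y => nu y *m E y ^+ k.+1))/vM.
pose c k y := (char_poly (E y))`_k.
exists (c 0%N); split.
- exact: polyfun_char_poly.
(* The constant coefficient at [x] is a sign, because [E x = 1]. *)
- by rewrite /c Ex char_poly_det det1 mulr1 signr_eq0.
- rewrite (_ : (fun y => _) =
      fun y => \sum_(k < n.+1) (- c k.+1 y) *: (nu y *m E y ^+ k.+1)).
    apply: vf_submodule_sum sM _ => k; apply: (MZ (fun y => - c k.+1 y)) => //.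
    exact/polyfun_opp/polyfun_char_poly.
  apply/funext => y; apply/eqP; rewrite -subr_eq0 -sumrN; apply/eqP.
  (* Applying Cayley-Hamilton to [nu y] expresses [c 0 y *: nu y] through positive powers of [E y],
     which [powM] places in [M]. *)
  transitivity (nu y *m horner_mx (E y) (char_poly (E y))).
    rewrite -[char_poly (E y)]coefK size_char_poly poly_def linear_sum /=.
    rewrite mulmx_sumr [RHS](eq_bigr (fun k : 'I_n.+2 => c k y *: (nu y *m E y ^+ k))).
      rewrite [RHS]big_ord_recl; congr (_ + _); first by rewrite mulmx1.
      by apply: eq_bigr => k _; rewrite scaleNr opprK.
    by move=> k _; rewrite linearZ /= rmorphXn /= horner_mx_X -scalemxAr.
  by rewrite Cayley_Hamilton mulmx0.
Qed.

(** The multipliers [f] with [f nu] in [M] form an ideal. It contains the equations of [X], as their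
    multiples of [nu] vanish on [X], so a common zero would lie on [X], where [full_fiber_local]
    forbids it. *)
Lemma full_fibers n (X : set (pt R n)) M nu :
  affine_alg_set X -> vf_submodule X M -> alg_vf X nu ->
  (forall x w, X x -> tangent X x w -> exists mu, M mu /\ mu x = w) -> M nu.
Proof.
move=> [m [F [pF XE]]] sM vnu fib; have [vM M0 MD MZ Meq] := sM.
pose J f := polyfun f /\ M (fun y => f y *: nu y).
have iJ : polyideal J.
  split=> [f []//||f g [pf Mf] [pg Mg]|f g pf [pg Mg]].
  - by split; [exact: PFconst|under eq_fun do rewrite scale0r].
  - split; first exact: PFadd.
    by under eq_fun do rewrite scalerDl; exact: MD.
  - split; first exact: PFmul.
    by under eq_fun do rewrite -scalerA; exact: MZ.
suff [_] : J (fun=> 1) by under eq_fun do rewrite scale1r.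
apply: contrapT => /(weak_nullstellensatz iJ)[x Jx].
have [Xx|nXx] := pselect (X x).
  have [f [pf /eqP fx Mf]] := full_fiber_local sM vnu (fun w => fib x w Xx).
  by apply: fx; apply: Jx.
apply: nXx; rewrite XE => j; apply: Jx; split; first exact: pF.
apply: (Meq _ _ M0); first exact: alg_vfZ.
by move=> y; rewrite XE => /(_ j) ->; rewrite scale0r.
Qed.

End FullFibers.

(** * From the fiber at [x0] to all fibers, and the density property *)

Unset Implicit Arguments.

Theorem theorem2p20 (R : realType) (n : nat) (X : set (pt R n))
  (L : set (pt R n -> pt R n)) (x0 : pt R n) :
  affine_alg_manifold X ->
  aut_transitive X ->
  vf_submodule X L ->
  (forall nu, L nu -> Lie_alg X nu) ->
  X x0 ->
  (exists F : seq (pt R n),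
      (forall v, v \in F -> exists nu, L nu /\ nu x0 = v) /\
      generating_subset X x0 F) ->
  algebraic_density X.
Proof.
move=> [Xalg _] trans sL LL Xx0 [F [FL [_ gen]]] nu vnu.
have sM := max_submodule_vf_submodule sL LL.
apply: max_submodule_Lie_alg; apply: (full_fibers Xalg sM vnu).
have fib0 w : tangent X x0 w -> exists mu, max_submodule X mu /\ mu x0 = w.
  move=> /gen[k [c [phi [v [phiP ->]]]]].
  have ex j : exists mu, max_submodule X mu /\ mu x0 = Dmap (phi j) x0 (v j).
    have [/alg_autP[psi pP] phi0 /FL[eta [Leta etav]]] := phiP j.
    exists (vf_pushforward (phi j) psi eta); split.
      exact/(max_submodule_pushforward pP)/(sub_max_submodule sL LL).
    have [_ _ /(_ _ Xx0)[_ _]] := pP; rewrite phi0 => psi0 _.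
    by rewrite /vf_pushforward psi0 etav dmapE.
  have [mu muP] := choice ex; have [_ _ _ MZ _] := sM.
  exists (fun x => \sum_(j < k) c j *: mu j x); split.
    apply: vf_submodule_sum sM _ => j.
    by apply: (MZ (fun=> c j)); [exact: PFconst|have [] := muP j].
  by apply: eq_bigr => j _; have [_ ->] := muP j.
move=> x w Xx tw; have [phi [/alg_autP[psi pP] phix]] := trans _ _ Xx0 Xx.
have [pphi ppsi H] := pP; have [_ _ psix _] := H _ Xx0; rewrite phix in psix.
(* The vector [w] is pulled back to [x0] by [psi], realised there by a field, and that field is
   pushed forward to [x] by [phi]. *)
have [eta [Meta etaE]] : exists mu, max_submodule X mu /\ mu x0 = dmap psi x w.
  apply: fib0; rewrite -psix.
  exact: (tangent_dmap (aut_pair_sym pP)).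
exists (vf_pushforward phi psi eta); split; first exact: (max_submodule_pushforward pP Meta).
rewrite /vf_pushforward psix etaE; apply/rowP => i.
(* The differentials of [phi] and [psi] compose to the identity on [w]: [phi \o psi] is the identity
   on [X] and [w] is tangent. *)
rewrite (dmap_coord _ _ _ pphi) -[in LHS]psix -(dfun_comp _ _ (pphi i) ppsi).
rewrite -(dfun_coord i x w); apply: dfun_eq_on tw _.
- exact: polyfun_comp (pphi i) ppsi.
- exact: PFcoord.
- by move=> y /H[_ _ _ yE] /=; rewrite yE.
Qed.
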